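(* Let $u(t)$, $t\ge 0$, be the solution to the constrained gradient flow $$\dot u(t) = -\nabla^2\Phi(u(t))^{-1}\big(\nabla f(u(t)) + A^\top c(u(t))\big),\qquad u(0)=u_0,$$ where $c(u)\in\mathbb R^m$ is the multiplier for which the constraint $Au(t)=b$ holds for all $t\ge 0$. Put $$D_\Phi(t)=\Phi(u^* )-\Phi(u(t))-\langle\nabla\Phi(u(t)),u^*-u(t)\rangle,\qquad D_f(t)=f(u^* )-f(u(t))-\langle\nabla f(u(t)),u^*-u(t)\rangle .$$ Assume that, for some real constant $\mu$, $D_f(t)\ge\mu D_\Phi(t)$ for all $t\ge 0$. Then $$D_\Phi(t)\le D_\Phi(0)\,e^{-\mu t}\qquad\text{for all } t\ge 0.$$
   Context: Setting: $\Omega\subset\mathbb R^n$ is convex, $f:\Omega\to\mathbb R$ is a convex differentiable function, $A\in\mathbb R^{m\times n}$, $b\in\mathbb R^m$ ($m\ge 0$; $m=0$ means no constraint). The problem $\min_{u\in\Omega:\,Au=b} f(u)$ is assumed to have a unique solution $u^*$. $\Phi:\Omega\to\mathbb R$ is twice differentiable and 1-strongly convex with respect to a given norm $\|\cdot\|_w$, i.e. $\Phi(x)-\Phi(y)-\nabla\Phi(y)^\top(x-y)\ge\frac12\|x-y\|_w^2$. The initial point $u_0\in\Omega$ satisfies $Au_0=b$ and the trajectory stays in $\Omega$. *)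

(* Defs.v *)
From HB Require Import structures.
From mathcomp Require Import all_boot all_order all_algebra.
From mathcomp Require Import all_classical all_reals all_analysis.

Set Implicit Arguments.
Unset Strict Implicit.
Unset Printing Implicit Defensive.

Import Order.TTheory GRing.Theory Num.Theory.
Import numFieldNormedType.Exports.

Local Open Scope classical_set_scope.
Local Open Scope ring_scope.

(* Fréchet expansion of f at x relative to D.  On a set D that need not be
   open this only involves the values of f on D; at an interior point of D it
   is ordinary differentiability with differential L, provided L is linear and
   continuous (as it is in every use below, the spaces being R and R^n). *)
Definition diff_within (R : realType) (V W : normedModType R)
    (D : set V) (f : V -> W) (x : V) (L : V -> W) : Prop :=
  let F := within D (nbhs x) in
  (fun y => f y - f x - L (y - x)) =o_F (fun y => y - x).

Definition dot (R : realType) (n : nat) (x y : 'cV[R]_n) : R :=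
  (x^T *m y) 0 0.

(* Gradients and Hessians are passed around as functions: they are uniquely
   determined on D when D is convex with nonempty interior, and on a
   lower-dimensional D any admissible choice is allowed. *)
Definition is_gradient_on (R : realType) (n : nat) (D : set 'cV[R]_n)
    (f : 'cV[R]_n -> R) (gradf : 'cV[R]_n -> 'cV[R]_n) : Prop :=
  forall x, D x -> diff_within D (f : _ -> R^o) x (fun h => dot (gradf x) h).

Definition is_jacobian_on (R : realType) (n m : nat) (D : set 'cV[R]_n)
    (F : 'cV[R]_n -> 'cV[R]_m) (J : 'cV[R]_n -> 'M[R]_(m, n)) : Prop :=
  forall x, D x -> diff_within D F x (fun h => J x *m h).

Definition is_hessian_on (R : realType) (n : nat) (D : set 'cV[R]_n)
    (Phi : 'cV[R]_n -> R) (gradPhi : 'cV[R]_n -> 'cV[R]_n)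
    (hessPhi : 'cV[R]_n -> 'M[R]_n) : Prop :=
  is_gradient_on D Phi gradPhi /\ is_jacobian_on D gradPhi hessPhi.

(* Two-sided derivative for t > 0, right derivative for t = 0. *)
Definition has_velocity (R : realType) (n : nat) (u : R -> 'cV[R]_n)
    (t : R) (v : 'cV[R]_n) : Prop :=
  diff_within [set s : R^o | 0 <= s] (u : R^o -> _) t (fun h => h *: v).

Record is_norm (R : realType) (V : lmodType R) (N : V -> R) : Prop := IsNorm {
  norm_triangle : forall x y, N (x + y) <= N x + N y ;
  norm_scale : forall (a : R) x, N (a *: x) = `|a| * N x ;
  norm_definite : forall x, N x = 0 -> x = 0 }.

Definition bregman (R : realType) (n : nat) (f : 'cV[R]_n -> R)
    (gradf : 'cV[R]_n -> 'cV[R]_n) (x y : 'cV[R]_n) : R :=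
  f x - f y - dot (gradf y) (x - y).

Definition strongly_convex1 (R : realType) (n : nat) (N : 'cV[R]_n -> R)
    (D : set 'cV[R]_n) (Phi : 'cV[R]_n -> R)
    (gradPhi : 'cV[R]_n -> 'cV[R]_n) : Prop :=
  forall x y, D x -> D y -> 2^-1 * N (x - y) ^+ 2 <= bregman Phi gradPhi x y.

Definition constrained_minimizer (R : realType) (n m : nat)
    (D : set 'cV[R]_n) (A : 'M[R]_(m, n)) (b : 'cV[R]_m)
    (f : 'cV[R]_n -> R) (x : 'cV[R]_n) : Prop :=
  [/\ D x, A *m x = b & forall y, D y -> A *m y = b -> f x <= f y].

(* [invmx] is a junk value on singular matrices.  If D has nonempty interior,
   strong convexity of the potential forces its Hessian to be invertible on D,
   and nothing is assumed; if D is lower-dimensional, the Hessian is not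
   controlled in the directions transverse to D, and [flow_inv] expresses that
   the inverse in the equation exists. *)
Record constrained_gradient_flow (R : realType) (n m : nat)
    (D : set 'cV[R]_n) (A : 'M[R]_(m, n)) (b : 'cV[R]_m)
    (gradf : 'cV[R]_n -> 'cV[R]_n) (hessPhi : 'cV[R]_n -> 'M[R]_n)
    (c : 'cV[R]_n -> 'cV[R]_m) (u0 : 'cV[R]_n) (u : R -> 'cV[R]_n) : Prop :=
  ConstrainedGradientFlow {
    flow_init : u 0 = u0 ;
    flow_dom : forall t, 0 <= t -> D (u t) ;
    flow_constraint : forall t, 0 <= t -> A *m u t = b ;
    flow_inv : D° = set0 -> forall t, 0 <= t -> hessPhi (u t) \in unitmx ;
    flow_eq : forall t, 0 <= t ->
      has_velocity u t
        (- (invmx (hessPhi (u t)) *m (gradf (u t) + A^T *m c (u t)))) }.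

(* Main.v *)
Require Import Defs.
From HB Require Import structures.
From mathcomp Require Import all_boot all_order all_algebra.
From mathcomp Require Import all_classical all_reals all_analysis.
From mathcomp Require Import ring lra.

Set Implicit Arguments.
Unset Strict Implicit.
Unset Printing Implicit Defensive.

Import Order.TTheory GRing.Theory Num.Theory.
Import numFieldNormedType.Exports.

Local Open Scope classical_set_scope.
Local Open Scope ring_scope.

(** Write D(t) for the Bregman divergence of Phi between ustar and u(t).
Differentiating along the flow, the terms in which gradPhi is paired with the
velocity u'(t) cancel and there remains
  D'(t) = - <H(u(t)) u'(t), ustar - u(t)>,  with H the Hessian of Phi.
By the flow equation H(u(t)) u'(t) = - (gradf(u(t)) + A^T c(u(t))), and the
multiplier term does not contribute, because
  <A^T c, ustar - u(t)> = <c, A ustar - A u(t)> = <c, b - b> = 0.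
Hence
  D'(t) = <gradf(u(t)), ustar - u(t)> = f(ustar) - f(u(t)) - D_f(t)
        <= - D_f(t) <= - mu D(t),
since ustar minimizes f among the feasible points, of which u(t) is one.
Gronwall's inequality ([gronwall_exp]) turns this into the exponential bound.

Two points need care. First, the derivatives of Phi are taken relative to the
domain, and u(t) may be one of its boundary points, so the derivative of D
([bregman_is_derive]) comes from a chain rule for curves that stay in the
domain ([velocity_comp]). It is an ordinary derivative for t > 0; at t = 0
right continuity is enough ([bregman_cvg_right0]). Second, the flow equation
only determines H(u(t)) u'(t) when H(u(t)) is invertible. If the domain has
an interior point, this follows from strong convexity, even at boundary points
and without symmetry of the Hessian ([hessian_unitmx]); if it has none,
invertibility belongs to the definition of the flow. *)

(** * The dot product and the maximum norm *)

Section Dot.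
Context {R : realType} {n : nat}.
Implicit Types x y z : 'cV[R]_n.

Lemma dotE x y : dot x y = \sum_(i < n) x i 0 * y i 0.
Proof. by rewrite /dot mxE; apply: eq_bigr => i _; rewrite mxE. Qed.

Lemma dotBl x y z : dot (x - y) z = dot x z - dot y z.
Proof. by rewrite /dot linearB /= mulmxBl !mxE. Qed.

Lemma dotDl x y z : dot (x + y) z = dot x z + dot y z.
Proof. by rewrite /dot linearD /= mulmxDl !mxE. Qed.

Lemma dotNl x z : dot (- x) z = - dot x z.
Proof. by rewrite /dot linearN /= mulNmx !mxE. Qed.

Lemma dotBr x y z : dot z (x - y) = dot z x - dot z y.
Proof. by rewrite /dot mulmxBr !mxE. Qed.

Lemma dotZr (a : R) x z : dot z (a *: x) = a * dot z x.
Proof. by rewrite /dot -scalemxAr !mxE. Qed.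

Lemma dot_mulTmx m (A : 'M[R]_(m, n)) (c : 'cV[R]_m) x :
  dot (A^T *m c) x = dot c (A *m x).
Proof. by rewrite /dot trmx_mul trmxK mulmxA. Qed.

End Dot.

Section MatrixNorm.
Context {R : realType}.

Lemma coord_le_norm m n (M : 'M[R]_(m, n)) i j : `|M i j| <= `|M|.
Proof.
rewrite [leRHS]/Num.norm /= mx_normrE.
exact: (@le_bigmax _ _ _ 0 (fun ij : 'I_m * 'I_n => `|M ij.1 ij.2|) (i, j)).
Qed.

Lemma norm_mulmx_le m n p (M : 'M[R]_(m, n)) (N : 'M[R]_(n, p)) :
  `|M *m N| <= n%:R * `|M| * `|N|.
Proof.
rewrite [leLHS]/Num.norm /= mx_normrE; apply: bigmax_le => [|[i j] _] /=.
  by rewrite !mulr_ge0.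
rewrite mxE (le_trans (ler_norm_sum _ _ _))//.
rewrite -[n in n%:R]card_ord -sumr_const -mulrA mulr_suml.
apply: ler_sum => k _; rewrite mul1r normrM.
by apply: ler_pM => //; exact: coord_le_norm.
Qed.

Lemma dot_le n (x y : 'cV[R]_n) : `|dot x y| <= n%:R * `|x| * `|y|.
Proof.
rewrite dotE (le_trans (ler_norm_sum _ _ _))//.
rewrite -[n in n%:R]card_ord -sumr_const -mulrA mulr_suml.
apply: ler_sum => k _; rewrite mul1r normrM.
by apply: ler_pM => //; exact: coord_le_norm.
Qed.

End MatrixNorm.

(** * Derivatives along curves defined for nonnegative times *)

Section DiffWithin.
Context {R : realType}.

Lemma diff_withinP (V W : normedModType R) (D : set V) (f : V -> W) x L :
  diff_within D f x L <->
  forall e, 0 < e ->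
    \forall y \near x, D y -> `|f y - f x - L (y - x)| <= e * `|y - x|.
Proof.
rewrite /diff_within; split=> [/eqoP h e e0|h].
  exact: h.
by apply/eqoP => e e0; exact: h.
Qed.

(** [has_velocity] for curves with values in any normed space, so that it also
applies to the scalar functions obtained by composing with the trajectory. *)
Definition velocity (W : normedModType R) (g : R -> W) (t : R) (v : W) :=
  diff_within [set s : R^o | 0 <= s] (g : R^o -> W) t (fun h => h *: v).

Lemma velocityP (W : normedModType R) (g : R -> W) t v :
  velocity g t v <-> forall e, 0 < e ->
    \forall s \near t, 0 <= s -> `|g s - g t - (s - t) *: v| <= e * `|s - t|.
Proof. exact: (@diff_withinP R^o). Qed.

Lemma velocity_lipschitz (W : normedModType R) (g : R -> W) t v :
  velocity g t v ->
  \forall s \near t, 0 <= s -> `|g s - g t| <= (`|v| + 1) * `|s - t|.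
Proof.
move=> /velocityP /(_ 1 ltr01); apply: filterS => s /[apply] h.
rewrite -[X in `|X|](subrK ((s - t) *: v)) (le_trans (ler_normD _ _))//.
by rewrite normrZ mulrDl addrC lerD// mulrC.
Qed.

Lemma velocity_within_cvg (W : normedModType R) (g : R -> W) t v :
  velocity g t v -> g s @[s --> within [set s | 0 <= s] (nbhs t)] --> g t.
Proof.
move=> /velocity_lipschitz h; apply/cvgrPdist_le => e e0.
have K0 : 0 < `|v| + 1 by rewrite ltr_wpDl.
have h' : \forall s \near t, `|t - s| <= e / (`|v| + 1).
  by apply: (@cvgr_dist_le _ R^o _ (nbhs t) _ id t) => //; rewrite divr_gt0.
rewrite near_withinE; near=> s => s0.
rewrite distrC (le_trans ((near h s _) s0))//.
rewrite -ler_pdivlMl// mulrC distrC.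
by near: s.
Unshelve. all: by end_near. Qed.

(** The chain rule. As the curve stays in [D], the expansion of [F] relative to
[D] is all that is ever used, even when [u t] is a boundary point of [D]. The
error splits into the remainder of [F], negligible against
|u s - u t| = O(|s - t|), and the image under [L] of the remainder of [u],
which boundedness of [L] keeps negligible against |s - t|. *)
Lemma velocity_comp n (W : normedModType R) (D : set 'cV[R]_n)
    (F : 'cV[R]_n -> W) (L : {linear 'cV[R]_n -> W}) K u t v :
  0 <= K -> (forall h, `|L h| <= K * `|h|) ->
  (forall s, 0 <= s -> D (u s)) ->
  diff_within D F (u t) L -> velocity u t v -> velocity (F \o u) t (L v).
Proof.
move=> K_ge0 LK uD /diff_withinP dF du; apply/velocityP => e e0 /=.
(* [K] and the norm of [v] may be zero, hence the added ones. *)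
have K0 : 0 < K + 1 by rewrite ltr_wpDl.
have B0 : 0 < `|v| + 1 by rewrite ltr_wpDl.
have e2 : 0 < e / 2 by rewrite divr_gt0.
have hF : \forall s \near t, 0 <= s -> D (u s) ->
    `|F (u s) - F (u t) - L (u s - u t)| <= e / 2 / (`|v| + 1) * `|u s - u t|.
  exact: (velocity_within_cvg du (dF _ (divr_gt0 e2 B0))).
have /velocityP/(_ (e / 2 / (K + 1)) (divr_gt0 e2 K0)) hu := du.
have hL := velocity_lipschitz du.
near=> s => s0.
have h1 : `|F (u s) - F (u t) - L (u s - u t)| <= e / 2 * `|s - t|.
  apply: (le_trans ((near hF s _) s0 (uD _ s0))) => //.
  rewrite -!mulrA ler_pM2l// ler_pM2l// ler_pdivrMl//.
  exact: ((near hL s _) s0).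
have h2 : `|L (u s - u t - (s - t) *: v)| <= e / 2 * `|s - t|.
  apply: (le_trans (LK _)).
  apply: (@le_trans _ _ ((K + 1) * (e / 2 / (K + 1) * `|s - t|))).
    apply: ler_pM => //; last exact: ((near hu s _) s0).
    by rewrite lerDl.
  by rewrite mulrA [(K + 1) * _]mulrC divfK ?gt_eqF.
have -> : F (u s) - F (u t) - (s - t) *: L v =
    (F (u s) - F (u t) - L (u s - u t)) + L (u s - u t - (s - t) *: v).
  by rewrite [L (_ - _ *: _)]linearB [L (_ *: _)]linearZ subrKA.
by rewrite (le_trans (ler_normD _ _))// [e]splitr mulrDl lerD.
Unshelve. all: by end_near. Qed.

Lemma velocity_coord n (u : R -> 'cV[R]_n) t v i :
  velocity u t v -> velocity (fun s => u s i 0 : R^o) t (v i 0).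
Proof.
move=> /velocityP h; apply/velocityP => e /h; apply: filterS => s /[apply].
apply: le_trans.
rewrite (_ : _ - _ = (u s - u t - (s - t) *: v) i 0) ?coord_le_norm//.
by rewrite !mxE.
Qed.

(** A positive time is interior to the half-line, so there the one-sided notion
gives an ordinary derivative; the product and sum rules for derivatives then
become available. *)
Lemma velocity_is_derive (g : R -> R) t d :
  0 < t -> velocity (g : R -> R^o) t d -> is_derive t (1 : R) g d.
Proof.
move=> t0 /velocityP h.
suff H : (fun h => h^-1 *: ((g \o shift t) (h *: (1 : R)) - g t)) @ 0^' --> d.
  by split; [apply/cvg_ex; exists d | apply/cvg_lim].
apply/cvgrPdist_le => e /h; rewrite (near_shift 0) subr0 => {}h.
have ht : \forall s \near (0 : R), 0 <= s + t.
  near=> s; rewrite -lerBlDr sub0r lerNl (le_trans (ler_norm _))// normrN.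
  by near: s; exact: (@nbhs0_le _ R^o).
rewrite near_withinE; near=> s => s0.
have := (near h s _); rewrite /= addrK => /(_ _ (near ht s _)) hs.
rewrite -(ler_pM2l (x := `|s|)) ?normr_gt0// -normrM mulrBr distrC.
rewrite /= [s%:A]mulr1 -[_ *: _]/(_ * _) mulrA mulfV// mul1r [leRHS]mulrC.
by apply: hs.
Unshelve. all: by end_near. Qed.

Lemma velocity_cvg_right0 (g : R -> R) d :
  velocity (g : R -> R^o) 0 d -> g x @[x --> 0^'+] --> g 0.
Proof.
move=> /velocity_within_cvg; apply: cvg_trans; apply: cvg_app.
by apply: within_subset => x /= /ltW.
Qed.

End DiffWithin.

(** * Functions, vector fields and dot products along a trajectory *)

Section Trajectory.
Context {R : realType} {n : nat}.

Lemma velocity_potential (D : set 'cV[R]_n) (F : 'cV[R]_n -> R) gradF u t v :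
  is_gradient_on D F gradF -> (forall s, 0 <= s -> D (u s)) -> 0 <= t ->
  velocity u t v -> velocity (F \o u : R -> R^o) t (dot (gradF (u t)) v).
Proof.
move=> dF uD t0 du.
pose L h : R^o := dot (gradF (u t)) h.
have linL : linear L.
  by move=> a x y; rewrite /L /dot mulmxDr -scalemxAr !mxE.
pose Llin := HB.pack_for {linear 'cV[R]_n -> R^o} L
  (GRing.isLinear.Build _ _ _ _ L linL).
apply: (@velocity_comp _ _ R^o D F Llin (n%:R * `|gradF (u t)|)) => //.
- by move=> h; exact: dot_le.
- exact: dF (uD t t0).
Qed.

Lemma velocity_field m (D : set 'cV[R]_n) (F : 'cV[R]_n -> 'cV[R]_m) J u t v :
  is_jacobian_on D F J -> (forall s, 0 <= s -> D (u s)) -> 0 <= t ->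
  velocity u t v -> velocity (F \o u) t (J (u t) *m v).
Proof.
move=> dF uD t0 du.
apply: (@velocity_comp _ _ _ D F (mulmx (J (u t))) (n%:R * `|J (u t)|)) => //.
- by move=> h; exact: norm_mulmx_le.
- exact: dF (uD t t0).
Qed.

Lemma is_derive_dot (a b : R -> 'cV[R]_n) t a' b' : 0 < t ->
  velocity a t a' -> velocity b t b' ->
  is_derive t (1 : R) (fun s => dot (a s) (b s)) (dot a' (b t) + dot (a t) b').
Proof.
move=> t0 da db.
have -> : (fun s => dot (a s) (b s)) =
    \sum_(i < n) ((fun s => a s i 0) * (fun s => b s i 0) : R -> R).
  by apply/funext => s; rewrite dotE fct_sumE.
rewrite !dotE -big_split /=.
apply: is_derive_sum => i.
have dai := velocity_is_derive t0 (velocity_coord i da).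
have dbi := velocity_is_derive t0 (velocity_coord i db).
apply: (is_derive_eq (is_deriveM dai dbi)).
by rewrite addrC; congr (_ + _); exact: mulrC.
Qed.

Lemma cvg_right0_dot (a b : R -> 'cV[R]_n) a' b' :
  velocity a 0 a' -> velocity b 0 b' ->
  dot (a s) (b s) @[s --> 0^'+] --> dot (a 0) (b 0).
Proof.
move=> da db; rewrite dotE.
under eq_fun do rewrite dotE.
apply: cvg_big => [|i _]; [exact: add_continuous|apply: cvgM];
  apply: velocity_cvg_right0.
- exact: velocity_coord da.
- exact: velocity_coord db.
Qed.

Lemma velocity_const_sub (w : 'cV[R]_n) u t v :
  velocity u t v -> velocity (fun s => w - u s) t (- v).
Proof.
move=> /velocityP h; apply/velocityP => e /h; apply: filterS => s /[apply].
apply: le_trans.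
rewrite [X in `|X| <= _](_ : _ = - (u s - u t - (s - t) *: v)) ?normrN//.
by rewrite scalerN opprK !opprB [w - u s + _]addrC subrKA addrC.
Qed.

End Trajectory.

(** * Invertibility of the Hessian of a strongly convex function *)

Section HessianInvertible.
Context {R : realType} {n : nat}.

Lemma convex_segment (D : set 'cV[R]_n) x y (s : R) :
  convex_set D -> D x -> D y -> 0 <= s <= 1 -> D (x + s *: (y - x)).
Proof.
move=> cD Dx Dy /andP[s0 s1].
have := cD y x (Itv01 s0 s1); rewrite !inE => /(_ Dy Dx).
suff -> : x + s *: (y - x) = s *: y + (1 - s) *: x by [].
by rewrite scalerBl scale1r scalerBr addrCA.
Qed.

Lemma bregmanC_add (F : 'cV[R]_n -> R) gradF x y :
  bregman F gradF x y + bregman F gradF y x =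
  dot (gradF x - gradF y) (x - y).
Proof. by rewrite /bregman !(dotBl, dotBr); ring. Qed.

(** Strong convexity is used in both directions, from [x] to [y] and from [y] to
[x]; adding the two inequalities leaves only gradients. *)
Lemma strongly_convex_monotone (N : 'cV[R]_n -> R) (D : set 'cV[R]_n)
    F gradF x y : is_norm N -> strongly_convex1 N D F gradF -> D x -> D y ->
  N (x - y) ^+ 2 <= dot (gradF x - gradF y) (x - y).
Proof.
move=> Nn sc Dx Dy; rewrite -(bregmanC_add F).
have := sc y x Dy Dx.
rewrite -(opprB x y) -scaleN1r (norm_scale Nn) normrN1 mul1r.
have := sc x y Dx Dy.
by lra.
Qed.

Lemma unitmx_inj (M : 'M[R]_n) :
  (forall v : 'cV[R]_n, M *m v = 0 -> v = 0) -> M \in unitmx.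
Proof.
move=> h; rewrite -unitmx_tr -row_free_unit.
apply: inj_row_free => v vM; apply: trmx_inj; rewrite trmx0; apply: h.
by rewrite -[M]trmxK -trmx_mul vM trmx0.
Qed.

Lemma near_right_segment (x a : 'cV[R]_n) (P : set 'cV[R]_n) :
  nbhs x P -> \forall s \near (0 : R)^'+, P (x + s *: a).
Proof.
move=> nP.
have : x + s *: a @[s --> (0 : R)^'+] --> x.
  rewrite -[X in _ --> X]addr0; apply: cvgD; first exact: cvg_cst.
  rewrite -(scale0r a); apply: cvgZr_tmp.
  by apply: cvg_at_right_filter; exact: cvg_id.
exact.
Qed.

(** If [z] is interior to [D] and [H x] kills [v], rescale [v] to a vector [w]
with [z + w] still in [D]. By convexity, the points at parameter [s] of the two
segments from [x] to [z + w] and from [x] to [z] are in [D], and they differ by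
[s *: w]. The gradients there differ by [H x *m (s *: w)] up to o(s), that is
by o(s), whereas strong monotonicity bounds the product of this difference with
[s *: w] from below by the square of [s * N w]. So [N w = 0]. Comparing two
moving points, instead of [x] with one of them, reaches every direction [w],
although [x] may be a boundary point from which few directions are
feasible. *)
Lemma hessian_unitmx (N : 'cV[R]_n -> R) (D : set 'cV[R]_n) F gradF H x :
  convex_set D -> is_norm N -> strongly_convex1 N D F gradF ->
  is_hessian_on D F gradF H -> D° !=set0 -> D x -> H x \in unitmx.
Proof.
move=> cD Nn sc [_ hH] [z Dz] Dx; apply: unitmx_inj => v Hv.
have Dz' : D z := interior_subset Dz.
have [e e0 Dw] : exists2 e : R, 0 < e & D (z + e *: v).
  have hs := near_right_segment v Dz.
  by near (0 : R)^'+ => e; exists e => //; exact: (near hs e).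
set w := e *: v in Dw.
have Hw : H x *m w = 0 by rewrite -scalemxAr Hv scaler0.
suff /(norm_definite Nn)/eqP : N w = 0.
  by rewrite scaler_eq0 gt_eqF//= => /eqP.
pose a := z + w - x; pose b := z - x.
have abw : a = b + w by rewrite /a addrAC.
have key d : 0 < d -> N w ^+ 2 <= d * (n%:R * (`|a| + `|b|) * `|w|).
  move=> d0.
  have hx := (diff_withinP _ _ _ _).1 (hH x Dx) d d0.
  have est c : \forall s \near (0 : R)^'+, D (x + s *: c) ->
      `|gradF (x + s *: c) - gradF x - H x *m (s *: c)| <= d * `|s *: c|.
    apply: filterS (near_right_segment c hx) => s.
    by rewrite (_ : x + s *: c - x = s *: c)// addrC addKr.
  near (0 : R)^'+ => s.
  have s0 : 0 < s by [].
  have s1 : s < 1 by near: s; exact: nbhs_right_lt.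
  have s01 : 0 <= s <= 1 by rewrite !ltW.
  have Da := convex_segment cD Dx Dw s01.
  have Db := convex_segment cD Dx Dz' s01.
  have := strongly_convex_monotone Nn sc Da Db; rewrite -/a -/b.
  have : `|gradF (x + s *: a) - gradF x - H x *m (s *: a)| <= d * `|s *: a|.
    by apply: (near (est a) s).
  have : `|gradF (x + s *: b) - gradF x - H x *m (s *: b)| <= d * `|s *: b|.
    by apply: (near (est b) s).
  have Eab : x + s *: a - (x + s *: b) = s *: w.
    by rewrite abw scalerDr addrA [X in X - _]addrC addrK.
  rewrite Eab (norm_scale Nn) gtr0_norm//.
  move: (gradF (x + s *: a)) (gradF (x + s *: b)) => ga gb hsb hsa mono.
  have hab : `|ga - gb| <= d * (s * (`|a| + `|b|)).
    have -> : ga - gb = (ga - gradF x - H x *m (s *: a))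
                      - (gb - gradF x - H x *m (s *: b)).
      rewrite abw scalerDr mulmxDr -[H x *m (s *: w)]scalemxAr Hw scaler0 addr0.
      by rewrite opprB addrA subrK opprB addrA subrK.
    rewrite (le_trans (ler_normB _ _))// !mulrDr lerD//.
      by rewrite (le_trans hsa)// normrZ gtr0_norm.
    by rewrite (le_trans hsb)// normrZ gtr0_norm.
  have {}mono : (s * N w) ^+ 2 <= n%:R * (d * (s * (`|a| + `|b|))) * (s * `|w|).
    apply: (le_trans mono); apply: (le_trans (ler_norm _)).
    apply: (le_trans (dot_le _ _)); rewrite normrZ [`|s|]gtr0_norm//.
    by rewrite ler_wpM2r ?ler_wpM2l// mulr_ge0// ltW.
  have s2 : 0 < s ^+ 2 by rewrite exprn_gt0.
  rewrite -(ler_pM2l s2) -exprMn (le_trans mono)// le_eqVlt; apply/orP; left.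
  by apply/eqP; ring.
have : N w ^+ 2 <= 0.
  set C := n%:R * _ * _ in key; have C0 : 0 <= C by rewrite !mulr_ge0.
  apply/ler_addgt0Pr => d d0; rewrite add0r.
  (* [C] may be zero, hence the choice of [d / (C + 1)]. *)
  have C1 : 0 < C + 1 by lra.
  apply: (le_trans (key _ (divr_gt0 d0 C1))).
  by rewrite mulrAC ler_pdivrMr// ler_pM2l// lerDl.
by rewrite le_eqVlt ltNge sqr_ge0 orbF expf_eq0 => /andP[_ /eqP].
Unshelve. all: by end_near. Qed.

End HessianInvertible.

(** * Gronwall's inequality *)

Section Gronwall.
Context {R : realType}.

(** The product of [g] with the integrating factor [expR (mu * t)] has
nonpositive derivative, hence is nonincreasing. *)
Lemma gronwall_exp (g dg : R -> R) (mu : R) :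
  g x @[x --> 0^'+] --> g 0 ->
  (forall t : R, 0 < t -> is_derive t (1 : R) g (dg t)) ->
  (forall t, 0 < t -> dg t <= - mu * g t) ->
  forall t, 0 <= t -> g t <= g 0 * expR (- mu * t).
Proof.
move=> g0 dgE dg_le t; rewrite le_eqVlt => /predU1P[<-|t0].
  by rewrite mulr0 expR0 mulr1.
pose E s := expR (mu * s).
have dE (s : R) : is_derive s (1 : R) E (mu * E s).
  have dm : is_derive s (1 : R) (mu \*: @id R) (mu *: (1 : R)).
    exact: is_deriveZ.
  apply: (is_derive_eq (is_derive1_comp (is_derive_expR _) dm)).
  by rewrite [mu%:A]mulr1 mulrC.
have dgE' (s : R) : 0 < s ->
    is_derive s (1 : R) (g * E) (g s *: (mu * E s) + E s *: dg s).
  by move=> s0; have := dgE s s0 => ?; exact: is_deriveM.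
have cgE : {within `[0, t], continuous (g * E)}.
  apply/continuous_within_itvP => //; split.
  - move=> s; rewrite in_itv/= => /andP[s0 _].
    by apply/differentiable_continuous/derivable1_diffP; case: (dgE' s s0).
  - apply: cvgM => //; apply: cvg_at_right_filter.
    by apply/differentiable_continuous/derivable1_diffP; case: (dE 0).
  - apply: cvg_at_left_filter.
    by apply/differentiable_continuous/derivable1_diffP; case: (dgE' t t0).
have := @ler0_derive1_le_cc R (g * E) 0 t _ _ cgE t 0.
rewrite !in_itv/= !lexx (ltW t0) /= => /(_ _ _ isT isT isT) mono.
have {}mono : g t * E t <= g 0 * E 0.
  apply: mono => s; rewrite in_itv/= => /andP[s0 _]; have d := dgE' s s0.
  - by case: d.
  - rewrite derive1E derive_val.
    have Es : 0 <= E s := expR_ge0 _.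
    have := ler_wpM2l Es (dg_le s s0).
    rewrite -![_ *: _]/(_ * _).
    by lra.
rewrite mulNr expRN ler_pdivlMr ?expR_gt0//.
by rewrite (le_trans mono)// /E mulr0 expR0 mulr1.
Qed.

End Gronwall.

(** * The Bregman divergence along a trajectory *)

Section Bregman.
Context {R : realType} {n : nat}.
Context (D : set 'cV[R]_n) (F : 'cV[R]_n -> R).
Context (gradF : 'cV[R]_n -> 'cV[R]_n) (H : 'cV[R]_n -> 'M[R]_n).
Context (hessF : is_hessian_on D F gradF H).
Context (u v : R -> 'cV[R]_n) (y : 'cV[R]_n).
Context (uD : forall s, 0 <= s -> D (u s)).
Context (du : forall s, 0 <= s -> velocity u s (v s)).

(** The derivative of [F (u s)] and that of the right factor [y - u s] in the dot
product contribute opposite terms, so only the derivative of the gradient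
survives. *)
Lemma bregman_is_derive (t : R) : 0 < t ->
  is_derive t (1 : R) (fun s => bregman F gradF y (u s))
    (- dot (H (u t) *m v t) (y - u t)).
Proof.
move=> t0; have t0' := ltW t0; have [gF hF] := hessF.
have dF := velocity_is_derive t0 (velocity_potential gF uD t0' (du t0')).
have dG := is_derive_dot t0 (velocity_field hF uD t0' (du t0'))
  (velocity_const_sub y (du t0')).
have dB := is_deriveB (is_deriveB (is_derive_cst (F y) t 1) dF) dG.
apply: (is_derive_eq dB).
by rewrite /= -[- v t]scaleN1r dotZr; ring.
Qed.

Lemma bregman_cvg_right0 :
  bregman F gradF y (u s) @[s --> (0 : R)^'+] --> bregman F gradF y (u 0).
Proof.
have [gF hF] := hessF; have d0 := du (lexx 0).
apply: cvgB.
  apply: cvgB; first exact: cvg_cst.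
  exact: (velocity_cvg_right0 (velocity_potential gF uD (lexx 0) d0)).
exact: (cvg_right0_dot (velocity_field hF uD (lexx 0) d0)
  (velocity_const_sub y d0)).
Qed.

End Bregman.

(** * Convergence of the constrained flow *)

Theorem theorem2 (R : realType) (n m : nat)
    (Omega : set 'cV[R]_n) (Omega_convex : convex_set Omega)
    (f : 'cV[R]_n -> R) (gradf : 'cV[R]_n -> 'cV[R]_n)
    (f_convex : convex_function Omega f)
    (f_diff : is_gradient_on Omega f gradf)
    (A : 'M[R]_(m, n)) (b : 'cV[R]_m)
    (ustar : 'cV[R]_n)
    (ustar_sol : unique (constrained_minimizer Omega A b f) ustar)
    (normw : 'cV[R]_n -> R) (normw_norm : is_norm normw)
    (Phi : 'cV[R]_n -> R) (gradPhi : 'cV[R]_n -> 'cV[R]_n)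
    (hessPhi : 'cV[R]_n -> 'M[R]_n)
    (Phi_diff2 : is_hessian_on Omega Phi gradPhi hessPhi)
    (Phi_strong : strongly_convex1 normw Omega Phi gradPhi)
    (u0 : 'cV[R]_n) (u0_dom : Omega u0) (u0_constraint : A *m u0 = b)
    (c : 'cV[R]_n -> 'cV[R]_m) (u : R -> 'cV[R]_n)
    (u_flow : constrained_gradient_flow Omega A b gradf hessPhi c u0 u)
    (mu : R)
    (Df_DPhi : forall t, 0 <= t ->
       mu * bregman Phi gradPhi ustar (u t) <= bregman f gradf ustar (u t)) :
  forall t, 0 <= t ->
    bregman Phi gradPhi ustar (u t) <=
    bregman Phi gradPhi ustar (u 0) * expR (- mu * t).
Proof.
have [_ uD uA uH uE] := u_flow.
have [[Ds As min_s] _] := ustar_sol.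
pose g t := gradf (u t) + A^T *m c (u t).
pose v t := - (invmx (hessPhi (u t)) *m g t).
have Hv t : 0 <= t -> hessPhi (u t) *m v t = - g t.
  move=> t0; rewrite mulmxN mulKVmx//.
  case: (pselect (Omega° = set0)) => [|/eqP] Omega0; first exact: uH.
  apply: (hessian_unitmx Omega_convex normw_norm Phi_strong Phi_diff2) => //.
  - exact/set0P.
  - exact: uD.
have dD := bregman_is_derive Phi_diff2 ustar uD uE.
have D0 := bregman_cvg_right0 (y := ustar) Phi_diff2 uD uE.
apply: (gronwall_exp D0 dD) => t /ltW t0.
rewrite -/(v t) Hv// dotNl opprK dotDl dot_mulTmx mulmxBr As uA// subrr.
rewrite [dot _ 0](_ : _ = 0) ?addr0; last by rewrite /dot mulmx0 mxE.
have := Df_DPhi t t0; have := min_s _ (uD t t0) (uA t t0).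
by rewrite mulNr /(bregman f); lra.
Qed.
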